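(* Let $V$ be a finite dimensional real vector space with a non-degenerate symmetric bilinear form $(\cdot,\cdot)$ of signature $(p,q)$, and let $J$ be a pseudo-Hermitian almost complex structure on $V$. Let $\phi,\phi_1,\phi_2$ be linear transformations of $V$, and let $c,c_0,c_1,c_2,c_3$ be arbitrary real constants. (1) If $\phi$ is admissible, then $cR_\phi$ is an almost complex Jordan IP algebraic curvature tensor. (2) If the pair $\{\phi_1,\phi_2\}$ is admissible, then $c_1R_{\phi_1}+c_2R_{\phi_2}$ is an almost complex Jordan IP algebraic curvature tensor. (3) The tensor $c_0R_{\mathrm{Id}}+c_1R_J$ is an almost complex Jordan IP algebraic curvature tensor. (4) Let $\{i,j,k\}$ be a skew-adjoint quaternion structure on $V$. Then the tensor $c_0R_{\mathrm{Id}}+c_1R_i+c_2R_j+c_3R_k$ is an almost complex Jordan IP algebraic curvature tensor relative to the pseudo-Hermitian almost complex structure given by $J=i$.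
   Context: The adjoint $\phi^*$ of a linear map $\phi$ of $V$ is defined by $(\phi v,w)=(v,\phi^*w)$ for all $v,w\in V$; $\phi$ is self-adjoint if $\phi^*=\phi$ and skew-adjoint if $\phi^*=-\phi$. If $\phi$ is self-adjoint, define $R_\phi(x,y,z,w):=(\phi y,z)(\phi x,w)-(\phi x,z)(\phi y,w)$. If $\phi$ is skew-adjoint, define $R_\phi(x,y,z,w):=(\phi y,z)(\phi x,w)-(\phi x,z)(\phi y,w)-2(\phi x,y)(\phi z,w)$. A 4-tensor $R$ (a multilinear map $R:V^4\to\mathbb{R}$) is an algebraic curvature tensor if for all $x,y,z,w\in V$: $R(x,y,z,w)=-R(y,x,z,w)$; $R(x,y,z,w)=R(z,w,x,y)$; and $R(x,y,z,w)+R(y,z,x,w)+R(z,x,y,w)=0$. The associated curvature operator $R(x,y):V\to V$ is the linear map defined by $(R(x,y)z,w)=R(x,y,z,w)$. A 2-plane $\pi\subset V$ is non-degenerate if the restriction of $(\cdot,\cdot)$ to $\pi$ is non-degenerate. If $\{x,y\}$ is an oriented basis of a non-degenerate oriented 2-plane $\pi$, the skew-symmetric curvature operator is $R(\pi):=|(x,x)(y,y)-(x,y)^2|^{-1/2}R(x,y)$. A pseudo-Hermitian almost complex structure $J$ on $V$ is a linear isometry of $(V,(\cdot,\cdot))$ with $J^2=-\mathrm{Id}$. A 2-plane $\pi$ is a complex line if $J\pi=\pi$; complex lines are oriented by bases of the form $\{x,Jx\}$. An algebraic curvature tensor $R$ is almost complex if $JR(\pi)=R(\pi)J$ for every non-degenerate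 complex line $\pi$. Two linear maps $T_1,T_2$ of the real vector space $V$ are Jordan equivalent (have the same Jordan normal form) if there is an invertible linear map $\psi$ of $V$ with $T_1=\psi T_2\psi^{-1}$. An almost complex algebraic curvature tensor $R$ is almost complex Jordan IP if the Jordan normal form of $R(\pi)$ is constant as $\pi$ ranges over all non-degenerate complex lines, i.e. $R(\pi)$ and $R(\pi')$ are Jordan equivalent for any two non-degenerate complex lines $\pi,\pi'$. A linear transformation $\phi$ of $V$ is admissible if both: (i) either $\phi=\phi^*$ and $\phi J=\pm J\phi$, or $\phi=-\phi^*$ and $J\phi=-\phi J$; and (ii) $\phi^2=\mathrm{Id}$, or $\phi^2=-\mathrm{Id}$, or ($\phi^2=0$ and $\ker\phi=\operatorname{range}\phi$). A pair $\{\phi_1,\phi_2\}$ of linear transformations of $V$ is admissible if: (i) both $\phi_1$ and $\phi_2$ are admissible; (ii) $\phi_1J=J\phi_1$, $\phi_2J=-J\phi_2$, and $\phi_1^*\phi_2+\phi_2^*\phi_1=0$; (iii) if $\phi_1^2=\phi_2^2=0$ and $\pi$ is any non-degenerate complex line, then $\phi_1\pi\cap\phi_2\pi=\{0\}$. A skew-adjoint quaternion structure on $V$ is a triple $\{i,j,k\}$ of skew-adjoint linear maps of $V$ satisfying the quaternion relations $i^2=j^2=k^2=-\mathrm{Id}$, $ij=-ji=k$, $jk=-kj=i$, $ki=-ik=j$. *)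

(* Defs.v *)
From HB Require Import structures.
From mathcomp Require Import all_boot all_order all_algebra.
From mathcomp Require Import sesquilinear ring lra.
From mathcomp Require Import boolp classical_sets reals.

Set Implicit Arguments.
Unset Strict Implicit.
Unset Printing Implicit Defensive.

Import Order.TTheory GRing.Theory Num.Theory.
Local Open Scope ring_scope.

Section Definitions.
Variables (R : realType) (V : vectType R) (g : {symmetric V}).
Implicit Types (phi psi J T A : 'End(V)) (pi : {vspace V}).

(* Signature (p, q): p timelike (negative) and q spacelike (positive)
   directions; as p and q are arbitrary the order is immaterial. *)
Definition has_signature (p q : nat) : Prop :=
  exists2 X : (p + q).-tuple V, basis_of fullv X &
    forall i j : 'I_(p + q),
      g X`_i X`_j = if i == j then (if (i < p)%N then -1 else 1) else 0.

(* The linear map A with (A z, w) = b z w for all z, w. It exists and is unique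
   when g is non-degenerate and b is bilinear (see repr_opE and repr_opP). *)
Definition repr_op (b : V -> V -> R) : 'End(V) :=
  xget (0 : 'End(V)) [set A : 'End(V) | forall z w, g (A z) w = b z w]%classic.

(* g (phi v) w = g v (adjoint phi w), see adjointE; the right-hand side is
   g (adjoint phi w) v by symmetry. *)
Definition adjoint phi : 'End(V) := repr_op (fun w v => g (phi v) w).

Definition self_adjoint phi : Prop := adjoint phi = phi.
Definition skew_adjoint phi : Prop := adjoint phi = - phi.

Definition tensor4 : Type := V -> V -> V -> V -> R.

Definition multilinear4 (S : tensor4) : Prop :=
  [/\ forall y z w, scalar (fun x => S x y z w),
      forall x z w, scalar (fun y => S x y z w),
      forall x y w, scalar (fun z => S x y z w)
    & forall x y z, scalar (fun w => S x y z w)].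

Definition algebraic_curvature_tensor (S : tensor4) : Prop :=
  [/\ multilinear4 S,
      forall x y z w, S x y z w = - S y x z w,
      forall x y z w, S x y z w = S z w x y
    & forall x y z w, S x y z w + S y z x w + S z x y w = 0].

(* Meaningful only when phi is self-adjoint or skew-adjoint; the last branch
   is a dummy value. If phi is both then phi = 0 and the two formulas agree. *)
Definition Rten phi : tensor4 := fun x y z w =>
  if adjoint phi == phi then
    g (phi y) z * g (phi x) w - g (phi x) z * g (phi y) w
  else if adjoint phi == - phi then
    g (phi y) z * g (phi x) w - g (phi x) z * g (phi y) w
      - 2 * g (phi x) y * g (phi z) w
  else 0.

Definition curvature_op (S : tensor4) (x y : V) : 'End(V) :=
  repr_op (fun z w => S x y z w).

(* The skew-symmetric curvature operator S(pi) of the 2-plane pi oriented by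
   the basis {x, y}. It depends only on the oriented plane, see
   oriented_plane_opE. *)
Definition oriented_plane_op (S : tensor4) (x y : V) : 'End(V) :=
  (Num.sqrt `|g x x * g y y - g x y ^+ 2|)^-1 *: curvature_op S x y.

Definition nondegenerate_plane pi : Prop :=
  \dim pi = 2%N /\ (pi :&: orthov g pi)%VS = 0%VS.

Definition complex_line J pi : Prop := \dim pi = 2%N /\ (J @: pi)%VS = pi.

(* S(pi) for a complex line pi, oriented by {x, J x}; x is the standard nonzero
   vector of pi, and any other choice of x gives the same operator, see
   complex_line_opE. *)
Definition complex_line_op J (S : tensor4) pi : 'End(V) :=
  oriented_plane_op S (vpick pi) (J (vpick pi)).

Definition pseudo_hermitian J : Prop :=
  isometry g g J /\ (J \o J)%VF = - \1%VF.

Definition jordan_equivalent T1 T2 : Prop :=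
  exists2 psi, lker psi == 0%VS & T1 = (psi \o T2 \o psi^-1)%VF.

Definition almost_complex J (S : tensor4) : Prop :=
  forall pi, complex_line J pi -> nondegenerate_plane pi ->
    (J \o complex_line_op J S pi)%VF = (complex_line_op J S pi \o J)%VF.

Definition almost_complex_jordan_IP J (S : tensor4) : Prop :=
  [/\ algebraic_curvature_tensor S,
      almost_complex J S
    & forall pi pi', complex_line J pi -> nondegenerate_plane pi ->
        complex_line J pi' -> nondegenerate_plane pi' ->
        jordan_equivalent (complex_line_op J S pi) (complex_line_op J S pi')].

Definition admissible J phi : Prop :=
  ((self_adjoint phi /\
      ((phi \o J)%VF = (J \o phi)%VF \/ (phi \o J)%VF = - (J \o phi)%VF))
   \/ (skew_adjoint phi /\ (J \o phi)%VF = - (phi \o J)%VF))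
  /\
  [\/ (phi \o phi)%VF = \1%VF,
      (phi \o phi)%VF = - \1%VF
    | (phi \o phi)%VF = 0 /\ lker phi = limg phi].

Definition admissible_pair J phi1 phi2 : Prop :=
  [/\ admissible J phi1 /\ admissible J phi2,
      [/\ (phi1 \o J)%VF = (J \o phi1)%VF,
          (phi2 \o J)%VF = - (J \o phi2)%VF
        & (adjoint phi1 \o phi2)%VF + (adjoint phi2 \o phi1)%VF = 0]
    & (phi1 \o phi1)%VF = 0 -> (phi2 \o phi2)%VF = 0 ->
      forall pi, complex_line J pi -> nondegenerate_plane pi ->
        (phi1 @: pi :&: phi2 @: pi)%VS = 0%VS].

Definition quaternion_structure (i j k : 'End(V)) : Prop :=
  [/\ [/\ skew_adjoint i, skew_adjoint j & skew_adjoint k],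
      [/\ (i \o i)%VF = - \1%VF, (j \o j)%VF = - \1%VF & (k \o k)%VF = - \1%VF],
      (i \o j)%VF = k /\ - (j \o i)%VF = k,
      (j \o k)%VF = i /\ - (k \o j)%VF = i
    & (k \o i)%VF = j /\ - (i \o k)%VF = j].

End Definitions.

Section Facts.
Variables (R : realType) (V : vectType R) (g : {symmetric V}).
Hypothesis g_nd : nondegenerate g.
Implicit Types (phi psi J A : 'End(V)) (pi : {vspace V}).

Lemma symC x y : g x y = g y x.
Proof. by rewrite (hermC (theta := idfun)) /= expr0 mul1r. Qed.

Lemma nondeg0 u : (forall w, g u w = 0) -> u = 0.
Proof.
move=> gu0; have := g_nd; rewrite /nondegenerate => /eqP rad0.
by apply/eqP; rewrite -memv0 -rad0; apply/mem_orthovP => w _; apply: gu0.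
Qed.

Lemma nondeg_inj u v : (forall w, g u w = g v w) -> u = v.
Proof.
move=> guv; apply/eqP; rewrite -subr_eq0; apply/eqP/nondeg0 => w.
by rewrite linearBl /= guv subrr.
Qed.

Lemma repr_op_exists (b : V -> V -> R) :
    (forall w, scalar (b^~ w)) -> (forall z, scalar (b z)) ->
  exists A : 'End(V), forall z w, g (A z) w = b z w.
Proof.
move=> bl br.
pose flat (u : V) : 'Hom(V, R^o) := linfun (g u : V -> R^o).
have flatE u w : flat u w = g u w by rewrite /flat lfunE.
have flat_lin : linear flat.
  move=> a u v; apply/lfunP => w.
  by rewrite add_lfunE scale_lfunE !flatE linearPl.
pose flatM := GRing.isLinear.Build _ _ _ _ flat flat_lin.
pose flatL : {linear V -> 'Hom(V, R^o)} := HB.pack flat flatM.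
pose F := linfun flatL.
have FE u w : F u w = g u w by rewrite lfunE /= flatE.
have kF : lker F == 0%VS.
  by apply/lker0P => u v Fuv; apply: nondeg_inj => w; rewrite -!FE Fuv.
have imF : limg F = fullv.
  apply/eqP; rewrite eqEdim subvf /= (limg_dim_eq _); last first.
    by rewrite (eqP kF) capv0.
  by rewrite !dimvf /dim /= muln1.
have FVK : forall h, F (F^-1%VF h) = h.
  by move=> h; apply: limg_lfunVK; rewrite imF memvf.
pose bzM z := GRing.isLinear.Build R V R^o _ (b z : V -> R^o) (br z).
pose bzL z : {linear V -> R^o} := HB.pack (b z : V -> R^o) (bzM z).
pose c z := linfun (bzL z).
have cE z w : c z w = b z w by rewrite lfunE.
have c_lin : linear c.
  move=> a u v; apply/lfunP => w.
  by rewrite add_lfunE scale_lfunE !cE bl.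
pose cM := GRing.isLinear.Build _ _ _ _ c c_lin.
pose cL : {linear V -> 'Hom(V, R^o)} := HB.pack c cM.
exists (F^-1 \o linfun cL)%VF => z w.
by rewrite -FE comp_lfunE FVK lfunE /= cE.
Qed.

Lemma repr_opE (b : V -> V -> R) :
    (forall w, scalar (b^~ w)) -> (forall z, scalar (b z)) ->
  forall z w, g (repr_op g b z) w = b z w.
Proof.
move=> bl br.
exact: (@xgetPex _ _ [set A : 'End(V) | forall z w, g (A z) w = b z w]%classic
  (repr_op_exists bl br)).
Qed.

Lemma repr_opP (b : V -> V -> R) A :
  (forall z w, g (A z) w = b z w) -> repr_op g b = A.
Proof.
move=> Ab; apply: xget_unique => // B Bb; apply/lfunP => z.
by apply: nondeg_inj => w; rewrite Ab Bb.
Qed.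

Lemma adjointE phi v w : g (phi v) w = g v (adjoint g phi w).
Proof.
rewrite [RHS]symC repr_opE // => [u a x y|u a x y].
  by rewrite linearPr.
by rewrite linearP linearPl.
Qed.

Lemma adjointP phi psi :
  (forall v w, g (phi v) w = g v (psi w)) <-> adjoint g phi = psi.
Proof.
split=> [adj|<- v w]; last exact: adjointE.
by apply: repr_opP => z w; rewrite adj symC.
Qed.

Lemma curvature_opE (S : tensor4 V) : multilinear4 S ->
  forall x y z w, g (curvature_op g S x y z) w = S x y z w.
Proof. by case=> _ _ S3 S4 x y; apply: repr_opE. Qed.

Lemma oriented_plane_opE (S : tensor4 V) (x y : V) (a b c d : R) :
    algebraic_curvature_tensor S -> 0 < a * d - b * c ->
  oriented_plane_op g S (a *: x + b *: y) (c *: x + d *: y)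
    = oriented_plane_op g S x y.
Proof.
case=> Sm Sa _ _ det_gt0; have [S1 S2 S3 S4] := Sm.
set D := a * d - b * c in det_gt0 *.
have Sxx u z w : S u u z w = 0.
  by have := Sa u u z w; lra.
have S1D u v y' z w p q :
    S (p *: u + q *: v) y' z w = p * S u y' z w + q * S v y' z w.
  have S0 : S 0 y' z w = 0.
    by have := S1 y' z w 1 0 0; rewrite scaler0 addr0; lra.
  by rewrite S1; have := S1 y' z w q v 0; rewrite addr0 S0 addr0 => ->.
have S2D u v y' z w p q :
    S y' (p *: u + q *: v) z w = p * S y' u z w + q * S y' v z w.
  by rewrite ![S y' _ _ _]Sa S1D; ring.
rewrite /oriented_plane_op.
have -> : curvature_op g S (a *: x + b *: y) (c *: x + d *: y)
    = D *: curvature_op g S x y.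
  apply: repr_opP => z w.
  rewrite scale_lfunE linearZl /= curvature_opE // S1D !S2D !Sxx [S y x _ _]Sa.
  by rewrite /D; ring.
rewrite scalerA.
have -> : g (a *: x + b *: y) (a *: x + b *: y)
    * g (c *: x + d *: y) (c *: x + d *: y)
    - g (a *: x + b *: y) (c *: x + d *: y) ^+ 2
    = D ^+ 2 * (g x x * g y y - g x y ^+ 2).
  rewrite !(linearDl, linearDr, linearZl_LR, linearZr_LR) /= [g y x]symC /D.
  by ring.
rewrite normrM ger0_norm ?sqr_ge0 // sqrtrM ?sqr_ge0 // sqrtr_sqr (gtr0_norm det_gt0).
by congr (_ *: _); rewrite invfM mulrAC mulVf ?mul1r // gt_eqF.
Qed.

Lemma complex_line_opE J (S : tensor4 V) pi (x : V) :
    algebraic_curvature_tensor S -> pseudo_hermitian g J ->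
    complex_line J pi -> x \in pi -> x != 0 ->
  complex_line_op g J S pi = oriented_plane_op g S x (J x).
Proof.
move=> Sc [_ J2] [dim_pi Jpi] x_pi x0.
have JJ u : J (J u) = - u.
  by have /lfunP/(_ u) := J2; rewrite comp_lfunE opp_lfunE id_lfunE.
rewrite /complex_line_op; set v := vpick pi.
have v_pi : v \in pi by apply: memv_pick.
have v0 : v != 0 by rewrite vpick0 -dimv_eq0 dim_pi.
have Jv_pi : J v \in pi by rewrite -Jpi memv_img.
have Jv_line : J v \notin <[v]>%VS.
  apply/negP => /vlineP [k Jv].
  have := JJ v; rewrite Jv linearZ /= Jv scalerA => /eqP.
  rewrite -subr_eq0 opprK -{2}[v]scale1r -scalerDl scaler_eq0 (negPf v0) orbF.
  by rewrite gt_eqF // ltr_wpDl ?ltr01 // -expr2 sqr_ge0.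
have span_pi : pi = (<[v]> + <[J v]>)%VS.
  apply/eqP; rewrite eq_sym eqEdim subv_add -!memvE v_pi Jv_pi dim_pi /=.
  rewrite dimv_disjoint_sum ?dim_vline ?v0.
    by case: eqP Jv_line => // ->; rewrite mem0v.
  apply/eqP; rewrite -subv0; apply/subvP => u /memv_capP [].
  move=> /vlineP [k ->] /vlineP [l kl]; rewrite memv0.
  have [l0|l0] := eqVneq l 0; first by rewrite kl l0 scale0r.
  case/negP: Jv_line; apply/vlineP; exists (l^-1 * k).
  by rewrite -scalerA kl scalerA mulVf // scale1r.
move: x_pi; rewrite span_pi => /memv_addP [_ /vlineP [a ->] [_ /vlineP [b ->]]].
move=> xE; have JxE : J x = (- b) *: v + a *: J v.
  by rewrite xE linearD !linearZ /= JJ scalerN scaleNr addrC.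
rewrite JxE xE oriented_plane_opE // mulrN opprK -!expr2.
rewrite lt_neqAle addr_ge0 ?sqr_ge0 // andbT eq_sym paddr_eq0 ?sqr_ge0 //.
rewrite !sqrf_eq0; apply/andP => -[/eqP a0 /eqP b0].
by move: x0; rewrite xE a0 b0 !scale0r addr0 eqxx.
Qed.

End Facts.

(* Main.v *)
(* A nondegenerate complex line contains x with e := (x,x) = 1 or -1, and the
   skew-symmetric curvature operator is then the J-linear map
     T z = e a J z + sum_l b_l ((J u_l, z) u_l - (u_l, z) J u_l),
   where u_l = phi_l x (or x, jx in the last two parts) satisfies
   (u_l, u_l) = e d_l and the complex lines of the u_l are mutually orthogonal;
   a, b_l and d_l do not depend on the line. If d_l <> 0 then u_l is an
   eigenvector of -JT; if d_l = 0, a vector w dual to u_l spans with it a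
   nilpotent Jordan block. Completing these vectors by orthogonal ones, on which
   T = e a J, gives a complex basis X with T X_i = e alpha_i J X_(sigma i), where
   alpha and sigma are the same for all lines. If X' is the basis for another
   line, with sign e', the map X' -> X extended complex linearly (e e' = 1) or
   antilinearly (e e' = -1) intertwines the two operators. *)

Require Import Defs.
From mathcomp Require Import all_boot all_order all_algebra.
From mathcomp Require Import sesquilinear ring lra zify boolp reals.
Set Implicit Arguments.
Unset Strict Implicit.
Unset Printing Implicit Defensive.
Import Order.TTheory GRing.Theory Num.Theory.
Local Open Scope ring_scope.

(** * Complex bases of a real vector space, and operators in normal form on them *)

Section ComplexFrames.
Variables (R : realType) (V : vectType R) (J : 'End(V)).
Hypothesis JJ : forall z, J (J z) = - z.
Implicit Types (X E Y : seq V) (T : 'End(V)) (K : {vspace V}).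

(** The complex span of [X] is the real span of [cseq X], and complex independence of [X] is
    [free (cseq X)]; the space itself stays real. *)
Definition cseq X := X ++ map J X.

Lemma mem_Jspan X z : (z \in <<cseq X>>)%VS -> (J z \in <<cseq X>>)%VS.
Proof.
move=> /(memv_img J); rewrite limg_span; apply/subvP/span_subvP => _ /mapP[y yX ->].
move: yX; rewrite mem_cat => /orP[yX|/mapP[x xX ->]].
  by apply: memv_span; rewrite mem_cat map_f // orbT.
by rewrite JJ memvN; apply: memv_span; rewrite mem_cat xX.
Qed.

Lemma perm_cseq_rcons X y : perm_eq (cseq (rcons X y)) (y :: J y :: cseq X).
Proof.
rewrite /cseq map_rcons -!cats1 -catA perm_sym -cat1s -[J y :: _]cat1s.
apply/permP => P; rewrite !count_cat /= !addn0.
by rewrite [RHS]addnCA; congr addn; rewrite [RHS]addnA [RHS]addnC.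
Qed.

(** If [y = k J y + s] with [s] in the span, applying [J] and substituting gives
    [(1 + k^2) y = k J s + s]. As [1 + k^2 > 0] and the span is [J]-stable, [y] would lie in it. *)
Lemma free_cseq_rcons X y :
  free (cseq X) -> (y \notin <<cseq X>>)%VS -> free (cseq (rcons X y)).
Proof.
move=> frX yX.
rewrite (perm_free (perm_cseq_rcons X y)) !free_cons frX andbT.
apply/andP; split; last first.
  by apply: contra yX => /mem_Jspan; rewrite JJ memvN.
apply: contra yX; rewrite span_cons => /memv_addP[_ /vlineP[k ->] [s sX yE]].
have : (1 + k ^+ 2) *: y \in <<cseq X>>%VS.
  have -> : (1 + k ^+ 2) *: y = k *: J s + s.
    have JyE : J y = - k *: y + J s.
      by rewrite {1}yE linearD linearZ /= JJ scalerN scaleNr.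
    rewrite scalerDl scale1r {1}yE JyE scalerDr scalerA mulrN -expr2 scaleNr.
    by rewrite addrAC [- _ + _]addrC subrK.
  by rewrite memvD ?memvZ // mem_Jspan.
move=> /(memvZ (1 + k ^+ 2)^-1); rewrite scalerA mulVf ?scale1r // gt_eqF //.
by rewrite ltr_pwDl ?ltr01 ?sqr_ge0.
Qed.

Lemma free_cseq1 u : u != 0 -> free (cseq [:: u]).
Proof.
move=> u0; rewrite -[[:: u]]/(rcons [::] u) free_cseq_rcons //.
  by rewrite nil_free.
by rewrite /cseq /= span_nil memv0.
Qed.

Lemma free_cseq2C u v : free (cseq [:: u; v]) = free (cseq [:: v; u]).
Proof.
by apply: perm_free; apply/permP => P /=; lia.
Qed.

(** By induction on the codimension of the complex span of [E]: while it is proper it cannot contain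
    [K], and a vector of [K] outside it is added together with its image under [J]. *)
Lemma cbasis_extend E K :
    free (cseq E) -> (<<cseq E>> + K = fullv)%VS ->
  exists Y, {subset Y <= K} /\ basis_of fullv (cseq (E ++ Y)).
Proof.
have [n] := ubnP (\dim {:V} - size (cseq E))%N.
elim: n E => // n IH E lt_n frE EK.
have [Efull|] := boolP (basis_of fullv (cseq E)).
  by exists [::]; rewrite cats0.
rewrite basisEfree frE subvf /= -ltnNge => ltE.
have [y yK yE] : exists2 y, y \in K & (y \notin <<cseq E>>)%VS.
  apply/subvPn; apply: contraL ltE => /addv_idPl KE.
  by rewrite -leqNgt -EK KE dim_span.
have szE : size (cseq (rcons E y)) = (size (cseq E)).+2.
  by rewrite /cseq !size_cat !size_map size_rcons addnS addSn.
have [||| Y [YK Yb]] := IH (rcons E y).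
- by rewrite szE -ltnS; apply: leq_trans lt_n; rewrite ltnS ltn_sub2l.
- exact: free_cseq_rcons.
- apply/eqP; rewrite eqEsubv subvf /= -EK addvS //.
  apply: sub_span => v; rewrite !mem_cat map_rcons !mem_rcons !in_cons.
  by case/orP => ->; rewrite !orbT.
exists (y :: Y); rewrite -cat_rcons; split=> // v.
by rewrite in_cons => /orP[/eqP ->|/YK].
Qed.

(* [X`_(sg i)] is 0 when [sg i] is out of range. *)
Definition cframe T (e : R) (al : nat -> R) (sg : nat -> nat) X : Prop :=
  basis_of fullv (cseq X) /\
  forall i, (i < size X)%N -> T X`_i = (e * al i) *: J X`_(sg i).

Lemma size_cbasis X : basis_of fullv (cseq X) -> (size X + size X = \dim {:V})%N.
Proof.
by move=> /andP[/eqP <- /eqnP ->]; rewrite size_cat size_map.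
Qed.

(* The intertwiner is complex linear or antilinear according to the sign [e * e']. *)
Lemma cframe_jordan_equivalent T T' e e' al sg X X' :
    (forall z, T (J z) = J (T z)) -> (forall z, T' (J z) = J (T' z)) ->
    e ^+ 2 = 1 -> e' ^+ 2 = 1 ->
    cframe T e al sg X -> cframe T' e' al sg X' ->
  jordan_equivalent T T'.
Proof.
move=> TJ T'J e2 e'2 [bX TX] [bX' TX'].
have szX : size X = size X'.
  by apply: double_inj; rewrite -!addnn !size_cbasis.
pose s := e * e'.
have s2 : s * s = 1 by rewrite /s; ring: e2 e'2.
(* The intertwiner sends [X'] to [X] and [J X'] to [s J X]; it exists because [cseq X'] is free. *)
have [f fP] := linear_of_free (cseq X') (X ++ map (fun x => s *: J x) X).
have {fP} := fP (basis_free bX') _; rewrite !size_cat !size_map szX => /(_ erefl).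
rewrite map_cat => /eqP; rewrite eqseq_cat ?size_map // => /andP[/eqP fX /eqP fJX].
have [psi psiE] : exists psi : 'End(V), psi =1 f by exists (linfun f); exact: lfunE.
(* Stated for every index, since [sg i] may be out of range; [X] and [X'] have equal length, so both
   entries are then 0. *)
have psiX i : psi X'`_i = X`_i.
  rewrite psiE; have [lti|gei] := ltnP i (size X').
    by rewrite -fX (nth_map 0).
  by rewrite !nth_default ?szX // linear0.
have psiJX i : psi (J X'`_i) = s *: J X`_i.
  have [lti|gei] := ltnP i (size X').
    have := congr1 (fun u => nth 0 u i) fJX.
    by rewrite psiE -map_comp !(nth_map 0) ?szX.
  by rewrite !nth_default ?szX // !linear0.
have basisP (h1 h2 : 'End(V)) : (forall i, (i < size X')%N -> h1 X'`_i = h2 X'`_i) ->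
    (forall i, (i < size X')%N -> h1 (J X'`_i) = h2 (J X'`_i)) -> h1 = h2.
  move=> hX hJX; apply/(fullv_lfunP _ _ (span_basis bX')) => v.
  rewrite mem_cat => /orP[/(nthP 0)[i lti <-]|/mapP[x /(nthP 0)[i lti <-] ->]].
    exact: hX.
  exact: hJX.
have psiJ z : psi (J z) = s *: J (psi z).
  have : (psi \o J)%VF = (s *: (J \o psi))%VF.
    apply: basisP => i lti; rewrite scale_lfunE !comp_lfunE /=.
      by rewrite psiX psiJX.
    by rewrite JJ psiJX linearN /= psiX linearZ /= JJ scalerA s2 scale1r.
  by move/(congr1 (fun h : 'End(V) => h z)); rewrite scale_lfunE !comp_lfunE.
have imgpsi : limg psi = fullv.
  apply/eqP; rewrite eqEsubv subvf -[Z in (Z <= _)%VS](span_basis bX).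
  apply/span_subvP => v; rewrite mem_cat.
  case/orP=> [/(nthP 0)[i lti <-]|/mapP[x /(nthP 0)[i lti <-] ->]].
    by rewrite -psiX memv_img ?memvf.
  have -> : J X`_i = psi (s *: J X'`_i) by rewrite linearZ /= psiJX scalerA s2 scale1r.
  by rewrite memv_img ?memvf.
have kpsi : lker psi == 0%VS.
  have /eqP := limg_ker_dim psi fullv.
  by rewrite imgpsi capfv -[X in _ == X]add0n eqn_add2r dimv_eq0.
exists psi => //.
suff H : (T \o psi = psi \o T')%VF.
  by rewrite -H lker0_compfK.
(* Both sides are multiples of [J] applied to the entry of [X] at [sg i], and the coefficients agree
   because [e' s = e e'^2 = e]. *)
have TpX i : (i < size X')%N -> T (psi X'`_i) = psi (T' X'`_i).
  move=> lti; rewrite psiX TX ?szX // TX' // linearZ /= psiJX scalerA.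
  by congr (_ *: _); rewrite /s; ring: e'2.
apply: basisP => i lti; rewrite !comp_lfunE; first exact: TpX.
by rewrite psiJ linearZ /= TJ TpX // T'J psiJ.
Qed.

Lemma memv_cspan E x p q : x \in E -> p *: x + q *: J x \in <<cseq E>>%VS.
Proof.
move=> xE; rewrite memvD ?memvZ //; first by rewrite memv_span ?mem_cat ?xE.
by rewrite memv_span ?mem_cat ?map_f ?orbT.
Qed.

(** [E] carries the exceptional part of [T]; the other basis vectors come from the kernel [K] of
    [T - e a J], which together with the complex span of [E] fills the space. On them the
    coefficient is [a] and the index is [i] itself, which explains the defaults of the two [nth]. *)
Lemma cframe_intro T e a E (A : seq R) (S : seq nat) :
    free (cseq E) -> size A = size E -> size S = size E ->
    (forall i, (i < size E)%N ->
       (nth i S i < size E)%N /\ T E`_i = (e * nth a A i) *: J E`_(nth i S i)) ->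
    (forall z, exists2 s, s \in <<cseq E>>%VS & T (z - s) = (e * a) *: J (z - s)) ->
  exists X, cframe T e (nth a A) (fun i => nth i S i) X.
Proof.
move=> frE szA szS TE EK.
pose K := lker (T - (e * a) *: J).
have KP z : (z \in K) = (T z == (e * a) *: J z).
  by rewrite memv_ker add_lfunE opp_lfunE scale_lfunE subr_eq0.
have [|Y [YK bY]] := @cbasis_extend E K frE.
  apply/eqP; rewrite eqEsubv subvf; apply/subvP => z _.
  have [s sE /eqP sK] := EK z.
  by rewrite -[z](subrK s) addrC memv_add // KP.
exists (E ++ Y); split=> // i; rewrite size_cat => lti.
have [ltiE|geiE] := ltnP i (size E).
  by have [ltS TEi] := TE i ltiE; rewrite !nth_cat ltiE ltS.
rewrite (@nth_default _ a) ?szA // (@nth_default _ i) ?szS // nth_cat ltnNge geiE /=.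
by apply/eqP; rewrite -KP YK // mem_nth // ltn_subLR.
Qed.

End ComplexFrames.

(** * Hermitian orthogonality, dual vectors and operators of complex rank one *)

Section HermitianFrames.
Variables (R : realType) (V : vectType R) (g : {symmetric V}) (J : 'End(V)).
Hypotheses (g_nd : nondegenerate g) (hJ : pseudo_hermitian g J).
Implicit Types (E : seq V) (T : 'End(V)) (u v w y z : V).

Lemma formDl u v w : g (u + v) w = g u w + g v w. Proof. exact: linearDl. Qed.
Lemma formDr u v w : g w (u + v) = g w u + g w v. Proof. exact: linearDr. Qed.
Lemma formNl u w : g (- u) w = - g u w. Proof. exact: linearNl. Qed.
Lemma formNr u w : g w (- u) = - g w u. Proof. exact: linearNr. Qed.
Lemma formZl a u w : g (a *: u) w = a * g u w. Proof. by rewrite linearZl_LR. Qed.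
Lemma formZr a u w : g w (a *: u) = a * g w u. Proof. by rewrite linearZr_LR. Qed.
Lemma form0l w : g 0 w = 0. Proof. exact: linear0l. Qed.
Lemma form0r w : g w 0 = 0. Proof. exact: linear0r. Qed.
Definition formE :=
  (formDl, formDr, formNl, formNr, formZl, formZr, form0l, form0r).

Lemma hermJJ z : J (J z) = - z.
Proof.
by case: hJ => _ /(congr1 (fun h : 'End(V) => h z));
  rewrite comp_lfunE opp_lfunE id_lfunE.
Qed.
Let JJ := hermJJ.

Lemma formJJ u v : g (J u) (J v) = g u v.
Proof. by case: hJ => /(_ u v). Qed.

Lemma formJr u v : g u (J v) = - g (J u) v.
Proof. by rewrite -formJJ JJ formNr. Qed.

Lemma form_Jid u : g (J u) u = 0.
Proof. by have := formJr u u; rewrite symC; lra. Qed.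

(** The complex span of [E] lies in the orthogonal of [u], and [y] does not. *)
Lemma notin_cspan u E y : {in E, forall x, g u x = 0 /\ g (J u) x = 0} ->
  g u y != 0 -> y \notin <<cseq J E>>%VS.
Proof.
move=> uE; apply: contraNN => yE; apply/eqP.
have /subvP/(_ _ yE) : (<<cseq J E>> <= orthov g <[u]>)%VS.
  apply/span_subvP => v; rewrite mem_cat mem_orthov1 symC.
  case/orP => [/uE[-> //]|/mapP[x /uE[_ gJux] ->]].
  by rewrite formJr gJux oppr0.
by rewrite mem_orthov1 symC => /eqP.
Qed.

(** The map [P = 1 - projv S] kills [S] but not [y], so some [t] has [(P y, t) <> 0]. The adjoint of
    [P] applied to [t], rescaled, is the required [w]. *)
Lemma exists_dual y (S : {vspace V}) : y \notin S ->
  exists2 w, g y w = 1 & {in S, forall s, g s w = 0}.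
Proof.
move=> yS; pose P := (\1 - projv S)%VF.
have PE v : P v = v - projv S v by rewrite /P add_lfunE opp_lfunE id_lfunE.
have Py0 : P y != 0.
  by rewrite PE subr_eq0; apply: contraNneq yS => ->; apply: memv_proj.
have [t t0] : exists t, g (P y) t != 0.
  apply: contrapT => tn; case/eqP: Py0; apply: (nondeg0 g_nd) => w.
  by apply: contrapT => /eqP ?; apply: tn; exists w.
exists ((g (P y) t)^-1 *: adjoint g P t) => [|s sS].
  by rewrite formZr -adjointE // mulVf.
by rewrite formZr -adjointE // (PE s) projv_id // subrr form0l mulr0.
Qed.

(** Freeness puts [u] outside the real span of [J u] and [cseq E], so a real dual vector for that
    span serves. The value [e] instead of 1 supplies the sign of the line in the Jordan chains
    below. *)
Lemma exists_cdual u E e : free (cseq J (rcons E u)) ->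
  exists w, [/\ g u w = e, g (J u) w = 0 &
    {in E, forall x, g x w = 0 /\ g (J x) w = 0}].
Proof.
rewrite (perm_free (perm_cseq_rcons J E u)) free_cons => /andP[/exists_dual].
case=> w uw w0 _; exists (e *: w); split=> [||x xE]; rewrite !formZr ?uw ?mulr1 //.
  by rewrite w0 ?mulr0 // memv_span ?mem_head.
by rewrite !w0 ?mulr0 // memv_span // !in_cons mem_cat ?map_f ?xE ?orbT.
Qed.

(** Orthogonality of the complex lines through [u] and [v], that is, for the Hermitian form with
    real part [g]. *)
Definition corth u v := g u v = 0 /\ g (J u) v = 0.

Lemma corthC u v : corth u v -> corth v u.
Proof. by case=> uv Juv; split; rewrite symC // formJr Juv oppr0. Qed.

Lemma corthJ u v : corth u v -> corth u (J v).
Proof. by case=> uv Juv; split; rewrite formJr ?JJ ?formNl ?Juv ?uv ?oppr0. Qed.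

Lemma corthP u p v q w : corth u v -> corth u w -> corth u (p *: v + q *: w).
Proof.
case=> uv Juv [uw Juw].
by split; rewrite formDr !formZr ?uv ?Juv ?uw ?Juw !mulr0 addr0.
Qed.

Lemma corthD u v w : corth u v -> corth u w -> corth u (v + w).
Proof. by move=> uv uw; have := corthP 1 1 uv uw; rewrite !scale1r. Qed.

Lemma lfun_comb (f : 'End(V)) p v q w : f (p *: v + q *: w) = p *: f v + q *: f w.
Proof. by rewrite linearD !linearZ. Qed.

(** With [h(z, u) = (u, z) + i (J u, z)], which is complex linear in [z], this is
    [z |-> - h(z, u) J u], of complex rank at most one. *)
Definition herm_op u z := g (J u) z *: u - g u z *: J u.

Lemma herm_op_corth u z : corth u z -> herm_op u z = 0.
Proof. by case=> uz Juz; rewrite /herm_op uz Juz !scale0r subrr. Qed.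

Lemma herm_op_dual u z : g (J u) z = 0 -> herm_op u z = - g u z *: J u.
Proof. by rewrite /herm_op => ->; rewrite scale0r sub0r scaleNr. Qed.

Lemma herm_opJ u z : herm_op u (J z) = J (herm_op u z).
Proof.
rewrite /herm_op linearB !linearZ /= !formJr !JJ formNl opprK.
by rewrite scaleNr opprK scalerN opprK addrC.
Qed.

(* The component of [z] along [y, J y], with [u] dual to [y]. *)
Definition cproj u y z := (g u y)^-1 *: (g u z *: y + g (J u) z *: J y).

Lemma memv_cproj E u y z : y \in E -> cproj u y z \in <<cseq J E>>%VS.
Proof. by move=> yE; apply/memvZ/memv_cspan. Qed.

Lemma cproj_dual u y z : g u y != 0 -> g (J u) y = 0 -> corth u (z - cproj u y z).
Proof.
move=> uy0 Juy; rewrite /cproj; split; rewrite !formE !formJr Juy ?JJ ?formE.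
  by field.
by field.
Qed.

Lemma cproj_corth u y v z : corth v y -> corth v (cproj u y z).
Proof.
move=> vy; rewrite /cproj scalerDr !scalerA.
by apply: corthP => //; apply: corthJ.
Qed.

(** The two corrections do not interfere: removing the part along [y2] leaves the pairing with [u1]
    unchanged, and vice versa. *)
Lemma cproj2_dual u1 y1 u2 y2 z :
    g u1 y1 != 0 -> g (J u1) y1 = 0 -> g u2 y2 != 0 -> g (J u2) y2 = 0 ->
    corth u1 y2 -> corth u2 y1 ->
  corth u1 (z - (cproj u1 y1 z + cproj u2 y2 z)) /\
  corth u2 (z - (cproj u1 y1 z + cproj u2 y2 z)).
Proof.
move=> u1y1 Ju1y1 u2y2 Ju2y2 u1y2 u2y1; split.
  rewrite opprD addrA; apply: corthD; first exact: cproj_dual.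
  by rewrite -[- _]scaleN1r -[_ *: _]addr0 -(scale0r (0 : V));
    apply: corthP; [apply: cproj_corth | split; rewrite form0r].
rewrite opprD addrCA; apply: corthD; last exact: cproj_dual.
by rewrite -[- _]scaleN1r -[_ *: _]addr0 -(scale0r (0 : V));
  apply: corthP; [apply: cproj_corth | split; rewrite form0r].
Qed.

(** * Normal forms of sums of one or two rank one operators *)

Lemma cframe_diag T e a b d u :
    e ^+ 2 = 1 -> d != 0 -> g u u = e * d ->
    (forall z, T z = (e * a) *: J z + b *: herm_op u z) ->
  exists X, cframe J T e (nth a [:: a - b * d]) (fun i => nth i [:: 0%N] i) X.
Proof.
move=> e2 d0 uu Tz.
have e0 : e != 0 by rewrite -sqrf_eq0 e2 oner_neq0.
have uu0 : g u u != 0 by rewrite uu mulf_neq0.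
have u0 : u != 0 by apply: contraNneq uu0 => ->; rewrite form0l.
apply: (@cframe_intro _ _ _ JJ T e a [:: u]) => //; first exact: free_cseq1.
  case=> // _; split=> //=.
  (* [T u = e a J u - b (u, u) J u = e (a - b d) J u]. *)
  rewrite Tz herm_op_dual ?form_Jid // scalerA -scalerDl uu.
  by congr (_ *: _); ring.
move=> z; exists (cproj u u z); first by rewrite memv_cproj ?mem_head.
by rewrite Tz herm_op_corth ?scaler0 ?addr0 //; apply: cproj_dual => //; apply: form_Jid.
Qed.

(** By complex orthogonality each rank one term vanishes on the vector of the other, so the
    eigenvalues are computed separately. *)
Lemma cframe_diag2 T e a b1 d1 u1 b2 d2 u2 :
    e ^+ 2 = 1 -> d1 != 0 -> g u1 u1 = e * d1 -> d2 != 0 -> g u2 u2 = e * d2 ->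
    corth u1 u2 ->
    (forall z, T z = (e * a) *: J z + b1 *: herm_op u1 z + b2 *: herm_op u2 z) ->
  exists X, cframe J T e (nth a [:: a - b1 * d1; a - b2 * d2])
                         (fun i => nth i [:: 0%N; 1%N] i) X.
Proof.
move=> e2 d10 u11 d20 u22 u12 Tz; have u21 := corthC u12.
have e0 : e != 0 by rewrite -sqrf_eq0 e2 oner_neq0.
have u110 : g u1 u1 != 0 by rewrite u11 mulf_neq0.
have u220 : g u2 u2 != 0 by rewrite u22 mulf_neq0.
have u10 : u1 != 0 by apply: contraNneq u110 => ->; rewrite form0l.
apply: (@cframe_intro _ _ _ JJ T e a [:: u1; u2]) => //.
- apply: (@free_cseq_rcons _ _ _ JJ [:: u1] u2); first exact: free_cseq1.
  by apply: (notin_cspan (u := u2)) => // x; rewrite inE => /eqP ->.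
- case=> [|[|//]] _; split=> //=.
    rewrite Tz herm_op_dual ?form_Jid // [herm_op u2 _]herm_op_corth //.
    by rewrite scaler0 addr0 scalerA -scalerDl u11; congr (_ *: _); ring.
  rewrite Tz [herm_op u2 _]herm_op_dual ?form_Jid // herm_op_corth //.
  by rewrite scaler0 addr0 scalerA -scalerDl u22; congr (_ *: _); ring.
move=> z; exists (cproj u1 u1 z + cproj u2 u2 z).
  by rewrite memvD ?memv_cproj // !inE eqxx ?orbT.
have [z1 z2] := cproj2_dual z u110 (form_Jid u1) u220 (form_Jid u2) u12 u21.
by rewrite Tz !herm_op_corth ?scaler0 ?addr0.
Qed.

(** Here [T u = 0], and the dual vector [w] satisfies [T w = - e b J u], whence the index 0 for [w].
    The coefficient of [u] is 0, so any index fits it. *)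
Lemma cframe_null T e b u :
    e ^+ 2 = 1 -> u != 0 -> g u u = 0 -> (forall z, T z = b *: herm_op u z) ->
  exists X, cframe J T e (nth 0 [:: 0; - b]) (fun i => nth i [:: 0%N; 0%N] i) X.
Proof.
move=> e2 u0 uu Tz.
have e0 : e != 0 by rewrite -sqrf_eq0 e2 oner_neq0.
have [w [uw Juw _]] := exists_cdual e (free_cseq1 JJ u0 : free (cseq J (rcons [::] u))).
have uw0 : g u w != 0 by rewrite uw.
apply: (@cframe_intro _ _ _ JJ T e 0 [:: u; w]) => //.
- apply: (@free_cseq_rcons _ _ _ JJ [:: u] w); first exact: free_cseq1.
  apply: (notin_cspan (u := u)) => // x; rewrite inE => /eqP ->.
  by rewrite form_Jid.
- case=> [|[|//]] _; split=> //=; rewrite Tz herm_op_dual ?form_Jid // scalerA.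
    by congr (_ *: _); rewrite uu; ring.
  by congr (_ *: _); rewrite uw; ring.
(* As [(u, u) = 0], orthogonality to [u] is reached by removing a component along [w]; [T] kills
   what remains. *)
move=> z; exists (cproj u w z); first by rewrite memv_cproj // !inE eqxx orbT.
by rewrite Tz herm_op_corth; [rewrite mulr0 scaler0 scale0r | apply: cproj_dual].
Qed.

(** The vector [w] dual to the isotropic [u2] is chosen orthogonal to the complex line of [u1], so
    the nilpotent block on [u2], [w] is separate from the eigenvector [u1]. *)
Lemma cframe_diag_null T e b1 d u1 b2 u2 :
    e ^+ 2 = 1 -> d != 0 -> g u1 u1 = e * d -> u2 != 0 -> g u2 u2 = 0 ->
    corth u1 u2 ->
    (forall z, T z = b1 *: herm_op u1 z + b2 *: herm_op u2 z) ->
  exists X, cframe J T e (nth 0 [:: 0; - (b1 * d); - b2])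
                         (fun i => nth i [:: 0%N; 1%N; 0%N] i) X.
Proof.
move=> e2 d0 u11 u20 u22 u12 Tz; have u21 := corthC u12.
have e0 : e != 0 by rewrite -sqrf_eq0 e2 oner_neq0.
have u110 : g u1 u1 != 0 by rewrite u11 mulf_neq0.
have u2u2 : corth u2 u2 by split; rewrite ?form_Jid.
have fr21 : free (cseq J [:: u2; u1]).
  apply: (@free_cseq_rcons _ _ _ JJ [:: u2] u1); first exact: free_cseq1.
  by apply: (notin_cspan (u := u1)) => // x; rewrite inE => /eqP ->.
have := fr21; rewrite free_cseq2C.
move=> /(@exists_cdual u2 [:: u1] e)[w [u2w Ju2w /(_ _ (mem_head _ _)) u1w]].
have u2w0 : g u2 w != 0 by rewrite u2w.
apply: (@cframe_intro _ _ _ JJ T e 0 [:: u2; u1; w]) => //.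
- apply: (@free_cseq_rcons _ _ _ JJ [:: u2; u1] w) => //.
  by apply: (notin_cspan (u := u2)) => // x; rewrite !inE => /orP[]/eqP ->.
- case=> [|[|[|//]]] _; split=> //=; rewrite Tz.
  + by rewrite !herm_op_corth // mulr0 !scaler0 scale0r addr0.
  + rewrite (herm_op_corth u21) scaler0 addr0 herm_op_dual ?form_Jid // scalerA.
    by congr (_ *: _); rewrite u11; ring.
  rewrite (herm_op_corth u1w) scaler0 add0r herm_op_dual // scalerA.
  by congr (_ *: _); rewrite u2w; ring.
move=> z; exists (cproj u1 u1 z + cproj u2 w z).
  by rewrite memvD ?memv_cproj // !inE eqxx ?orbT.
have [z1 z2] := cproj2_dual z u110 (form_Jid u1) u2w0 Ju2w u1w u21.
by rewrite Tz !herm_op_corth // mulr0 !scaler0 addr0 scale0r.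
Qed.

(** Two nilpotent blocks: each [w] is dual to its own [u] and orthogonal to the complex line of the
    other. Orthogonal isotropic vectors may be dependent, hence the freeness hypothesis. *)
Lemma cframe_null2 T e b1 u1 b2 u2 :
    e ^+ 2 = 1 -> free (cseq J [:: u1; u2]) -> g u1 u1 = 0 -> g u2 u2 = 0 ->
    corth u1 u2 ->
    (forall z, T z = b1 *: herm_op u1 z + b2 *: herm_op u2 z) ->
  exists X, cframe J T e (nth 0 [:: 0; 0; - b1; - b2])
                         (fun i => nth i [:: 0%N; 1%N; 0%N; 1%N] i) X.
Proof.
move=> e2 fr12 u11 u22 u12 Tz; have u21 := corthC u12.
have e0 : e != 0 by rewrite -sqrf_eq0 e2 oner_neq0.
have u1u1 : corth u1 u1 by split; rewrite ?form_Jid.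
have u2u2 : corth u2 u2 by split; rewrite ?form_Jid.
have [w2 [u2w Ju2w /(_ _ (mem_head _ _)) u1w]] := @exists_cdual u2 [:: u1] e fr12.
have := fr12; rewrite free_cseq2C.
move=> /(@exists_cdual u1 [:: u2] e)[w1 [u1w1 Ju1w1 /(_ _ (mem_head _ _)) u2w1]].
have u1w0 : g u1 w1 != 0 by rewrite u1w1.
have u2w0 : g u2 w2 != 0 by rewrite u2w.
apply: (@cframe_intro _ _ _ JJ T e 0 [:: u1; u2; w1; w2]) => //.
- apply: (@free_cseq_rcons _ _ _ JJ [:: u1; u2; w1] w2).
    apply: (@free_cseq_rcons _ _ _ JJ [:: u1; u2] w1) => //.
    by apply: (notin_cspan (u := u1)) => // x; rewrite !inE => /orP[]/eqP ->.
  apply: (notin_cspan (u := u2)) => // x; rewrite !inE.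
  by case/orP=> [|/orP[]]/eqP ->.
- case=> [|[|[|[|//]]]] _; split=> //=; rewrite Tz.
  + by rewrite !herm_op_corth // mulr0 !scaler0 scale0r addr0.
  + by rewrite !herm_op_corth // mulr0 !scaler0 scale0r addr0.
  + rewrite (herm_op_corth u2w1) scaler0 addr0 herm_op_dual // scalerA.
    by congr (_ *: _); rewrite u1w1; ring.
  rewrite (herm_op_corth u1w) scaler0 add0r herm_op_dual // scalerA.
  by congr (_ *: _); rewrite u2w; ring.
move=> z; exists (cproj u1 w1 z + cproj u2 w2 z).
  by rewrite memvD ?memv_cproj // !inE eqxx ?orbT.
have [z1 z2] := cproj2_dual z u1w0 Ju1w1 u2w0 Ju2w u1w u2w1.
by rewrite Tz !herm_op_corth // mulr0 !scaler0 addr0 scale0r.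
Qed.

End HermitianFrames.



(** * The tensors of self-adjoint and skew-adjoint maps and their linear combinations *)

Section CurvatureTensors.
Variables (R : realType) (V : vectType R) (g : {symmetric V}).
Hypothesis g_nd : nondegenerate g.
Implicit Types (phi : 'End(V)) (S : tensor4 V).

Lemma self_adjointP phi :
  self_adjoint g phi <-> forall v w, g (phi v) w = g v (phi w).
Proof. exact: iff_sym (adjointP g_nd phi phi). Qed.

Lemma skew_adjointP phi :
  skew_adjoint g phi <-> forall v w, g (phi v) w = - g v (phi w).
Proof.
split=> [/(adjointP g_nd) H v w|H]; first by rewrite H opp_lfunE formNr.
by apply/(adjointP g_nd) => v w; rewrite H opp_lfunE formNr.
Qed.

Lemma Rten_self phi x y z w : self_adjoint g phi ->
  Rten g phi x y z w = g (phi y) z * g (phi x) w - g (phi x) z * g (phi y) w.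
Proof. by move=> sa; rewrite /Rten sa eqxx. Qed.

Lemma Rten_skew phi x y z w : skew_adjoint g phi ->
  Rten g phi x y z w = g (phi y) z * g (phi x) w - g (phi x) z * g (phi y) w
    - 2 * g (phi x) y * g (phi z) w.
Proof.
(* If the test for self-adjointness succeeds as well, then [phi = 0] and both formulas vanish. *)
move=> sk; rewrite /Rten sk eqxx; case: ifP => // /eqP phiN.
have phi0 v : phi v = 0.
  have := congr1 (fun h : 'End(V) => h v) phiN; rewrite opp_lfunE => phiNv.
  apply: (nondeg0 g_nd) => t; have := congr1 (g^~ t) phiNv.
  by rewrite /= formNl; lra.
by rewrite !phi0 !form0l; ring.
Qed.

(** All identities follow from the symmetry or antisymmetry of [(phi v, w)]. In the skew case the
    cyclic sum of the first two terms doubles up, and the term with factor 2 cancels it. *)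
Lemma curvature_tensor_Rten phi :
  self_adjoint g phi \/ skew_adjoint g phi -> algebraic_curvature_tensor (Rten g phi).
Proof.
have sym := symC g.
case=> [sa|sk].
  have F x y z w := Rten_self x y z w sa; have A := (self_adjointP phi).1 sa.
  have B v w : g (phi v) w = g (phi w) v by rewrite A sym.
  split=> [|x y z w|x y z w|x y z w]; rewrite ?F.
  - by split=> ? ? ? a u v; rewrite !F !linearD !linearZ /= ?formE; ring.
  - by ring.
  - by rewrite (B z y) (B w x) (B z x) (B w y); ring.
  by rewrite (B z x) (B z y) (B y x); ring.
have F x y z w := Rten_skew x y z w sk; have A := (skew_adjointP phi).1 sk.
have B v w : g (phi v) w = - g (phi w) v by rewrite A sym.
split=> [|x y z w|x y z w|x y z w]; rewrite ?F.
- by split=> ? ? ? a u v; rewrite !F !linearD !linearZ /= ?formE; ring.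
- by rewrite (B y x); ring.
- by rewrite (B z y) (B w x) (B z x) (B w y); ring.
by rewrite (B z x) (B z y) (B y x); ring.
Qed.

Lemma curvature_tensorZ c S : algebraic_curvature_tensor S ->
  algebraic_curvature_tensor (fun x y z w => c * S x y z w).
Proof.
case=> -[S1 S2 S3 S4] Sa Ss Sb; split=> [|x y z w|x y z w|x y z w].
- by split=> ? ? ? a u v; rewrite ?S1 ?S2 ?S3 ?S4 /=; ring.
- by rewrite Sa; ring.
- by rewrite Ss.
by rewrite -!mulrDr Sb mulr0.
Qed.

Lemma curvature_tensorD S S' :
    algebraic_curvature_tensor S -> algebraic_curvature_tensor S' ->
  algebraic_curvature_tensor (fun x y z w => S x y z w + S' x y z w).
Proof.
case=> -[S1 S2 S3 S4] Sa Ss Sb [[S1' S2' S3' S4'] Sa' Ss' Sb'].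
split=> [|x y z w|x y z w|x y z w].
- split=> ? ? ? a u v.
  + by rewrite S1 S1' /=; ring.
  + by rewrite S2 S2' /=; ring.
  + by rewrite S3 S3' /=; ring.
  by rewrite S4 S4' /=; ring.
- by rewrite Sa Sa'; ring.
- by rewrite Ss Ss'.
by have := Sb x y z w; have := Sb' x y z w; lra.
Qed.

End CurvatureTensors.

(** * Curvature operators of complex lines, and admissible maps *)

Section ComplexLines.
Variables (R : realType) (V : vectType R) (g : {symmetric V}) (J : 'End(V)).
Hypotheses (g_nd : nondegenerate g) (hJ : pseudo_hermitian g J).
Implicit Types (phi : 'End(V)) (S : tensor4 V) (pi : {vspace V}).

Let JJ := hermJJ hJ.

Lemma complex_line_span pi v : complex_line J pi -> v \in pi -> v != 0 ->
  pi = <<cseq J [:: v]>>%VS.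
Proof.
move=> [dim_pi Jpi] vpi v0; apply/eqP; rewrite eq_sym eqEdim dim_pi.
rewrite (eqnP (free_cseq1 JJ v0)) andbT; apply/span_subvP => y.
by rewrite !inE => /orP[]/eqP -> //; rewrite -Jpi memv_img.
Qed.

(** Since [(v, J v) = 0], an isotropic [v] would be orthogonal to its whole complex line; so a
    nonzero [v] can be rescaled to [(x, x) = 1] or [-1]. *)
Lemma complex_line_unit pi : complex_line J pi -> nondegenerate_plane g pi ->
  exists2 x, x \in pi & g x x ^+ 2 = 1.
Proof.
move=> cl [dim_pi nd]; set v := vpick pi.
have vpi : v \in pi by apply: memv_pick.
have v0 : v != 0 by rewrite vpick0 -dimv_eq0 dim_pi.
have gvv : g v v != 0.
  apply/eqP => gvv; case/negP: (v0); rewrite -memv0 -nd memv_cap vpi /=.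
  suff /subvP : (pi <= orthov g <[v]>)%VS.
    by move=> piv; apply/mem_orthovP => y /piv; rewrite mem_orthov1 symC => /eqP.
  rewrite (complex_line_span cl vpi v0); apply/span_subvP => y.
  rewrite !inE mem_orthov1 symC => /orP[]/eqP ->; first by rewrite gvv.
  by rewrite (formJr hJ) (form_Jid hJ) oppr0.
exists ((Num.sqrt `|g v v|)^-1 *: v); first exact: memvZ.
rewrite formZl formZr mulrA -invfM -expr2 sqr_sqrtr // exprMn exprVn.
by rewrite -normrX ger0_norm ?sqr_ge0 // mulVf // sqrf_eq0.
Qed.

Lemma complex_line_op_unit S pi x :
    algebraic_curvature_tensor S -> complex_line J pi -> x \in pi ->
    g x x ^+ 2 = 1 ->
  complex_line_op g J S pi = curvature_op g S x (J x).
Proof.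
move=> St cl xpi x1; rewrite (complex_line_opE g_nd St hJ cl xpi); last first.
  by apply: contra_eq_neq x1 => ->; rewrite form0l expr0n eq_sym oner_neq0.
rewrite /oriented_plane_op (formJJ hJ) (formJr hJ) (form_Jid hJ) oppr0 expr0n subr0.
by rewrite -expr2 x1 normr1 sqrtr1 invr1 scale1r.
Qed.

(** [al] and [sg] are fixed before the line is chosen; only the sign [(x, x)] varies, and frames of
    either sign give Jordan equivalent operators. *)
Lemma jordan_IP_of_cframes S al sg :
    algebraic_curvature_tensor S ->
    (forall pi x (T : 'End(V)), complex_line J pi ->
       nondegenerate_plane g pi -> x \in pi ->
       g x x ^+ 2 = 1 -> (forall z w, g (T z) w = S x (J x) z w) ->
       (forall z, T (J z) = J (T z)) /\ exists X, cframe J T (g x x) al sg X) ->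
  almost_complex_jordan_IP g J S.
Proof.
move=> St H; split=> // [pi cl nd|pi pi' cl nd cl' nd'].
  have [x xpi x1] := complex_line_unit cl nd.
  have [|TJ _] := H pi x (complex_line_op g J S pi) cl nd xpi x1.
    move=> z w; rewrite (complex_line_op_unit St cl xpi x1).
  by rewrite curvature_opE //; case: St.
  by apply/lfunP => z; rewrite !comp_lfunE TJ.
have [x xpi x1] := complex_line_unit cl nd.
have [x' xpi' x1'] := complex_line_unit cl' nd'.
have [|TJ [X XP]] := H pi x (complex_line_op g J S pi) cl nd xpi x1.
  move=> z w; rewrite (complex_line_op_unit St cl xpi x1).
  by rewrite curvature_opE //; case: St.
have [|TJ' [X' XP']] := H pi' x' (complex_line_op g J S pi') cl' nd' xpi' x1'.
  move=> z w; rewrite (complex_line_op_unit St cl' xpi' x1').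
  by rewrite curvature_opE //; case: St.
exact: cframe_jordan_equivalent XP XP'.
Qed.

(** Treats all admissible cases at once: [s] is the sign with which [phi] commutes with [J]. If the
    adjoint of [phi] is [t phi] and [phi^2 = r Id], then [(phi x, phi x) = t (x, phi^2 x) = t r (x,
    x)], so [d = t r]. *)
Lemma admissible_structure phi : admissible g J phi -> exists s d : R,
  [/\ self_adjoint g phi \/ skew_adjoint g phi,
      forall x z w, Rten g phi x (J x) z w = s * g (herm_op g J (phi x) z) w,
      forall x, g (phi x) (phi x) = d * g x x,
      forall x, g x x != 0 -> phi x != 0
    & d = 0 -> (phi \o phi)%VF = 0].
Proof.
case=> adj sq.
have [s sP] : exists s, forall x z w,
    Rten g phi x (J x) z w = s * g (herm_op g J (phi x) z) w.
  case: adj => [[sa [phiJ|phiJ]]|[sk phiJ]].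
  - exists 1 => x z w; rewrite (Rten_self _ _ _ _ sa).
    have := congr1 (fun h : 'End(V) => h x) phiJ; rewrite !comp_lfunE => ->.
    by rewrite /herm_op !formE; ring.
  - exists (-1) => x z w; rewrite (Rten_self _ _ _ _ sa).
    have := congr1 (fun h : 'End(V) => h x) phiJ; rewrite opp_lfunE !comp_lfunE => ->.
    by rewrite /herm_op !formE; ring.
  exists (-1) => x z w; rewrite (Rten_skew g_nd _ _ _ _ sk).
  have := congr1 (fun h : 'End(V) => h x) phiJ; rewrite opp_lfunE !comp_lfunE => /eqP.
  rewrite -eqr_oppLR => /eqP phiJx; rewrite -phiJx.
  (* This removes the extra term of the skew-adjoint formula. *)
  have -> : g (phi x) (J x) = 0.
    have A := (skew_adjointP g_nd phi).1 sk.
    have := A x (J x); rewrite -phiJx formNr opprK (formJr hJ) [RHS]symC.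
    by lra.
  by rewrite /herm_op !formE; ring.
have adj' : self_adjoint g phi \/ skew_adjoint g phi.
  by case: adj => [[sa _]|[sk _]]; [left|right].
have [t [t2 tP]] : exists t, t != 0 /\ forall v w, g (phi v) w = t * g v (phi w).
  case: adj' => [/(self_adjointP g_nd) A|/(skew_adjointP g_nd) A].
    by exists 1; split=> [|v w]; rewrite ?oner_neq0 // A mul1r.
  by exists (-1); split=> [|v w]; rewrite ?oppr_eq0 ?oner_neq0 // A mulN1r.
have [r rP [kr r0]] : exists2 r, forall x, g (phi x) (phi x) = t * r * g x x
    & (forall x, g x x != 0 -> phi x != 0) /\ (r = 0 -> (phi \o phi)%VF = 0).
  have inj (r : R) : (forall x, g (phi x) (phi x) = t * r * g x x) -> r != 0 ->
      forall x, g x x != 0 -> phi x != 0.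
    move=> rP r0 x; apply: contraNneq => phix0; have := rP x; rewrite phix0 form0l.
    by move/esym/eqP; rewrite !mulf_eq0 (negPf t2) (negPf r0).
  have phiphi x h : (phi \o phi)%VF = h -> phi (phi x) = h x.
    by move=> <-; rewrite comp_lfunE.
  case: sq => [sq|sq|[sq ker]].
  - have rP x : g (phi x) (phi x) = t * 1 * g x x.
      by rewrite tP (phiphi _ _ sq) id_lfunE mulr1.
    exists 1 => //; split; first by apply: inj rP _; rewrite oner_neq0.
    by move/eqP; rewrite oner_eq0.
  - have rP x : g (phi x) (phi x) = t * -1 * g x x.
      by rewrite tP (phiphi _ _ sq) opp_lfunE id_lfunE formNr; ring.
    exists (-1) => //; split; first by apply: inj rP _; rewrite oppr_eq0 oner_neq0.
    by move/eqP; rewrite oppr_eq0 oner_eq0.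
  exists 0 => [x|]; first by rewrite tP (phiphi _ _ sq) zero_lfunE form0r; ring.
  (* If [phi x = 0] then [x = phi y], as kernel and range coincide, and
     [(x, x) = t (y, phi^2 y) = 0]. *)
  split=> // x; apply: contraNneq => /eqP; rewrite -memv_ker ker.
  case/memv_imgP => y _ ->; apply/eqP.
  by rewrite tP (phiphi _ _ sq) zero_lfunE form0r mulr0.
exists s, (t * r); split=> // /eqP; rewrite mulf_eq0 (negPf t2) /= => /eqP; exact: r0.
Qed.

Lemma jordan_IP_Rten phi c : admissible g J phi ->
  almost_complex_jordan_IP g J (fun x y z w => c * Rten g phi x y z w).
Proof.
move=> /admissible_structure[s [d [adj sP dP phi0 _]]].
have St := curvature_tensorZ c (curvature_tensor_Rten g_nd adj).
have TE x (T : 'End(V)) : (forall z w, g (T z) w = c * Rten g phi x (J x) z w) ->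
    forall z, T z = (c * s) *: herm_op g J (phi x) z.
  move=> Tg z; apply: (nondeg_inj g_nd) => w.
  by rewrite Tg sP formZl mulrA.
have TJ x (T : 'End(V)) : (forall z w, g (T z) w = c * Rten g phi x (J x) z w) ->
    forall z, T (J z) = J (T z).
  by move=> /TE Tz z; rewrite !Tz herm_opJ // linearZ.
have [d0|d0] := eqVneq d 0.
  apply: (jordan_IP_of_cframes St) => pi x T _ _ _ x1 Tg; split; first exact: TJ Tg.
  apply: (cframe_null g_nd hJ x1 (phi0 x _) _ (TE _ _ Tg)).
    by rewrite -sqrf_eq0 x1 oner_neq0.
  by rewrite dP d0 mul0r.
apply: (jordan_IP_of_cframes St) => pi x T _ _ _ x1 Tg; split; first exact: TJ Tg.
apply: (cframe_diag hJ (a := 0) x1 d0 (u := phi x)); first by rewrite dP mulrC.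
by move=> z; rewrite (TE _ _ Tg) mulr0 scale0r add0r.
Qed.

Lemma jordan_IP_Rten_pair phi1 phi2 c1 c2 : admissible_pair g J phi1 phi2 ->
  almost_complex_jordan_IP g J (fun x y z w =>
    c1 * Rten g phi1 x y z w + c2 * Rten g phi2 x y z w).
Proof.
case=> -[/admissible_structure[s1 [d1 [adj1 sP1 dP1 phi10 nil1]]]].
move=> /admissible_structure[s2 [d2 [adj2 sP2 dP2 phi20 nil2]]].
case=> phi1J phi2J phi12 disj.
have St := curvature_tensorD
  (curvature_tensorZ c1 (curvature_tensor_Rten g_nd adj1))
  (curvature_tensorZ c2 (curvature_tensor_Rten g_nd adj2)).
have phi1Jx x : phi1 (J x) = J (phi1 x).
  by have := congr1 (fun h : 'End(V) => h x) phi1J; rewrite !comp_lfunE.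
have phi2Jx x : phi2 (J x) = - J (phi2 x).
  by have := congr1 (fun h : 'End(V) => h x) phi2J; rewrite opp_lfunE !comp_lfunE.
have polar x y : g (phi1 x) (phi2 y) + g (phi2 x) (phi1 y) = 0.
  rewrite !adjointE // -formDr.
  have := congr1 (fun h : 'End(V) => h y) phi12.
  by rewrite add_lfunE !comp_lfunE zero_lfunE => ->; rewrite form0r.
(* [polar] is used at [(x, x)] and [(x, J x)]. At the latter, [phi1] commutes and [phi2]
   anticommutes with [J], so the two terms are equal and add up. *)
have orth x : corth g J (phi1 x) (phi2 x).
  split; first by have := polar x x; rewrite [g (phi2 x) _]symC; lra.
  have := polar x (J x); rewrite phi1Jx phi2Jx formNr !(formJr hJ) opprK.
  rewrite [g (J (phi2 x)) _]symC (formJr hJ); lra.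
have TE x (T : 'End(V)) : (forall z w, g (T z) w =
      c1 * Rten g phi1 x (J x) z w + c2 * Rten g phi2 x (J x) z w) ->
    forall z, T z = (c1 * s1) *: herm_op g J (phi1 x) z
                    + (c2 * s2) *: herm_op g J (phi2 x) z.
  move=> Tg z; apply: (nondeg_inj g_nd) => w.
  by rewrite Tg sP1 sP2 /herm_op !formE; ring.
have TJ x (T : 'End(V)) : (forall z w, g (T z) w =
      c1 * Rten g phi1 x (J x) z w + c2 * Rten g phi2 x (J x) z w) ->
    forall z, T (J z) = J (T z).
  by move=> /TE Tz z; rewrite !Tz !(herm_opJ hJ) lfun_comb.
have gx0 x : g x x ^+ 2 = 1 -> g x x != 0.
  by move=> x1; rewrite -sqrf_eq0 x1 oner_neq0.
have [d10|d10] := eqVneq d1 0; have [d20|d20] := eqVneq d2 0.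
- apply: (jordan_IP_of_cframes St) => pi x T cl nd xpi x1 Tg; split; first exact: TJ Tg.
  (* A dependence would put [phi2 x] into the complex line of [phi1 x], which lies in [phi1 pi]
     because [J phi1 x = phi1 J x]; but [phi1 pi] meets [phi2 pi] in 0. *)
  have frx : free (cseq J [:: phi1 x; phi2 x]).
    apply: (@free_cseq_rcons _ _ _ JJ [:: phi1 x] (phi2 x)).
      by apply: (free_cseq1 JJ); apply/phi10/gx0.
    apply: contra (phi20 x (gx0 x x1)) => phi2x.
    rewrite -memv0 -(disj (nil1 d10) (nil2 d20) pi cl nd) memv_cap memv_img // andbT.
    move: phi2x; apply/subvP/span_subvP => y; rewrite !inE => /orP[]/eqP ->.
      exact: memv_img.
    by rewrite -phi1Jx memv_img // -[pi](proj2 cl) memv_img.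
  apply: (cframe_null2 g_nd hJ x1 frx _ _ (orth x) (TE _ _ Tg)).
    by rewrite dP1 d10 mul0r.
  by rewrite dP2 d20 mul0r.
- apply: (jordan_IP_of_cframes St) => pi x T cl nd xpi x1 Tg; split; first exact: TJ Tg.
  (* The roles are exchanged: [phi2 x] is the non-isotropic vector. *)
  apply: (cframe_diag_null g_nd hJ x1 d20 (u1 := phi2 x) (u2 := phi1 x)).
  + by rewrite dP2 mulrC.
  + exact/phi10/gx0.
  + by rewrite dP1 d10 mul0r.
  + exact: corthC.
  by move=> z; rewrite (TE _ _ Tg) addrC.
- apply: (jordan_IP_of_cframes St) => pi x T cl nd xpi x1 Tg; split; first exact: TJ Tg.
  apply: (cframe_diag_null g_nd hJ x1 d10 (u1 := phi1 x)
           (u2 := phi2 x) _ _ _ _ (TE _ _ Tg)).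
  + by rewrite dP1 mulrC.
  + exact/phi20/gx0.
  + by rewrite dP2 d20 mul0r.
  exact: orth.
apply: (jordan_IP_of_cframes St) => pi x T cl nd xpi x1 Tg; split; first exact: TJ Tg.
apply: (cframe_diag2 hJ (a := 0) x1 d10 (u1 := phi1 x) _ d20 (u2 := phi2 x)).
- by rewrite dP1 mulrC.
- by rewrite dP2 mulrC.
- exact: orth.
by move=> z; rewrite (TE _ _ Tg) mulr0 scale0r add0r.
Qed.

Lemma skew_adjoint_complex : skew_adjoint g J.
Proof. by apply/skew_adjointP => // v w; rewrite (formJr hJ) opprK. Qed.

Lemma jordan_IP_Rten_id_J c0 c1 :
  almost_complex_jordan_IP g J (fun x y z w =>
    c0 * Rten g \1%VF x y z w + c1 * Rten g J x y z w).
Proof.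
have sk := skew_adjoint_complex.
have sa : self_adjoint g \1%VF by apply/self_adjointP => // v w; rewrite !id_lfunE.
have St := curvature_tensorD
  (curvature_tensorZ c0 (curvature_tensor_Rten g_nd (or_introl sa)))
  (curvature_tensorZ c1 (curvature_tensor_Rten g_nd (or_intror sk))).
apply: (jordan_IP_of_cframes St) => pi x T _ _ _ x1 Tg.
(* The identity and [J] contribute the same rank one term; the factor 2 term of the tensor of [J]
   gives [- 2 c1 (x, x) J z]. *)
have Tz z : T z = (g x x * (- 2 * c1)) *: J z + (c0 + c1) *: herm_op g J x z.
  apply: (nondeg_inj g_nd) => w.
  rewrite Tg Rten_self // Rten_skew // !id_lfunE JJ (formJJ hJ) /herm_op !formE.
  by ring.
split=> [z|]; first by rewrite !Tz herm_opJ // lfun_comb.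
apply: (cframe_diag hJ x1 (oner_neq0 R) _ Tz).
by rewrite mulr1.
Qed.

End ComplexLines.

(** * Quaternion structures *)

Section Quaternions.
Variables (R : realType) (V : vectType R) (g : {symmetric V}) (i j k : 'End(V)).
Hypotheses (g_nd : nondegenerate g) (hq : quaternion_structure g i j k).

Lemma quaternion_pseudo_hermitian : pseudo_hermitian g i.
Proof.
case: hq => -[/(skew_adjointP g_nd) iP _ _] [ii _ _] _ _ _; split=> // u v.
by have := congr1 (fun h : 'End(V) => h v) ii;
  rewrite comp_lfunE opp_lfunE id_lfunE iP => ->; rewrite formNr opprK.
Qed.

Lemma jordan_IP_quaternion c0 c1 c2 c3 :
  almost_complex_jordan_IP g i (fun x y z w =>
    c0 * Rten g \1%VF x y z w + c1 * Rten g i x y z w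
      + c2 * Rten g j x y z w + c3 * Rten g k x y z w).
Proof.
have hi := quaternion_pseudo_hermitian.
case: hq => -[iA jA kA] [ii jj kk] [ij ji] [jk kj] [ki ik].
have app (h h' : 'End(V)) x : h = h' -> h x = h' x by move=> ->.
have iix x : i (i x) = - x by have := app _ _ x ii; rewrite comp_lfunE opp_lfunE id_lfunE.
have jjx x : j (j x) = - x by have := app _ _ x jj; rewrite comp_lfunE opp_lfunE id_lfunE.
have ijx x : i (j x) = k x by have := app _ _ x ij; rewrite comp_lfunE.
have jix x : j (i x) = - k x.
  by have := app _ _ x ji; rewrite opp_lfunE comp_lfunE => <-; rewrite opprK.
have kix x : k (i x) = j x by have := app _ _ x ki; rewrite comp_lfunE.
have jP := (skew_adjointP g_nd j).1 jA; have kP := (skew_adjointP g_nd k).1 kA.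
have gj x : g (j x) x = 0 by have := jP x x; rewrite [g x _]symC; lra.
have gk x : g (k x) x = 0 by have := kP x x; rewrite [g x _]symC; lra.
have sa : self_adjoint g \1%VF by apply/self_adjointP => // v w; rewrite !id_lfunE.
have St phi c adj := curvature_tensorZ c (curvature_tensor_Rten (phi := phi) g_nd adj).
have Stt := curvature_tensorD (curvature_tensorD (curvature_tensorD
  (St _ c0 (or_introl sa)) (St _ c1 (or_intror iA)))
  (St _ c2 (or_intror jA))) (St _ c3 (or_intror kA)).
apply: (jordan_IP_of_cframes g_nd hi Stt) => pi x T _ _ _ x1 Tg.
(* As [k x = i j x], the maps [j] and [k] give the same operator, minus the rank one term of [j x];
   their factor 2 terms vanish because [j x] and [k x] are orthogonal to [i x]. *)
have Tz z : T z = (g x x * (- 2 * c1)) *: i z + (c0 + c1) *: herm_op g i x z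
    + (- (c2 + c3)) *: herm_op g i (j x) z.
  apply: (nondeg_inj g_nd) => w.
  rewrite Tg Rten_self // !(Rten_skew g_nd) // !id_lfunE iix jix kix (formJJ hi).
  rewrite (formJr hi (j x)) (formJr hi (k x)) -[k x]ijx iix /herm_op !formE.
  by rewrite ijx gj gk; ring.
split=> [z|].
  by rewrite !Tz !(herm_opJ hi) [RHS]linearD /= lfun_comb
              [X in _ = _ + X]linearZ.
apply: (cframe_diag2 hi x1 (oner_neq0 R) _ (oner_neq0 R) _ _ Tz).
- by rewrite mulr1.
- by rewrite jP jjx formNr opprK mulr1.
split; first by rewrite symC gj.
by rewrite symC (formJr hi) ijx gk oppr0.
Qed.

End Quaternions.

Theorem theorem8 (R : realType) (V : vectType R) (g : {symmetric V})
    (p q : nat) (J phi phi1 phi2 : 'End(V)) (c c0 c1 c2 c3 : R) :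
  nondegenerate g -> has_signature g p q -> pseudo_hermitian g J ->
  [/\ (admissible g J phi ->
         almost_complex_jordan_IP g J (fun x y z w => c * Rten g phi x y z w)),
      (admissible_pair g J phi1 phi2 ->
         almost_complex_jordan_IP g J (fun x y z w =>
           c1 * Rten g phi1 x y z w + c2 * Rten g phi2 x y z w)),
      almost_complex_jordan_IP g J (fun x y z w =>
        c0 * Rten g \1%VF x y z w + c1 * Rten g J x y z w)
    & forall i j k : 'End(V), quaternion_structure g i j k ->
        pseudo_hermitian g i /\
        almost_complex_jordan_IP g i (fun x y z w =>
          c0 * Rten g \1%VF x y z w + c1 * Rten g i x y z w
            + c2 * Rten g j x y z w + c3 * Rten g k x y z w)].

Proof.
move=> g_nd _ hJ; split=> [| | |i j k hq].
- exact: jordan_IP_Rten.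
- exact: jordan_IP_Rten_pair.
- exact: jordan_IP_Rten_id_J.
split; first exact: (quaternion_pseudo_hermitian g_nd hq).
exact: (jordan_IP_quaternion g_nd hq).
Qed.
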